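(* Let $\Delta$ be a reflexive polytope in $M_{\mathbb R}$ and $\Delta=\Delta_0+\Delta_1+\cdots+\Delta_k$ be a Minkowski sum decomposition by lattice polytopes in $M_{\mathbb R}$. Denote $$\hat\nabla_0=\mathrm{Conv}\Bigl(\bigl\{u-\sum_{i=1}^k\min\langle\Delta_i,u\rangle e_i^*\mid u\in\Delta^*\bigr\}\cup\{e_1^*,\dots,e_k^*\}\Bigr),\qquad\hat\nabla_i=\hat\nabla_0-e_i^*\ \ (i=1,\dots,k)$$ in $\tilde N_{\mathbb R}$. Then $\hat\nabla_0+\dots+\hat\nabla_k=(k+1)\hat\nabla_0+e_0^*$ is a reflexive polytope in $\tilde N_{\mathbb R}=N_{\mathbb R}\oplus\mathbb R^k$ with the dual reflexive polytope $$(\hat\nabla_0+\dots+\hat\nabla_k)^*=\mathrm{Conv}(\Delta_0+e_0,\Delta_1+e_1,\dots,\Delta_k+e_k)$$ in $\tilde M_{\mathbb R}=M_{\mathbb R}\oplus\mathbb R^k$, where $e_0=-\sum_{i=1}^ke_i$ and $e_0^*=-\sum_{i=1}^ke_i^*$.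
   Context: $M$ and $N$ are dual lattices of finite rank with real extensions $M_{\mathbb R},N_{\mathbb R}$. A lattice polytope (vertices at lattice points) $\Delta\subset M_{\mathbb R}$ is reflexive if it contains $0$ in its interior and $\Delta^*=\{n\in N_{\mathbb R}\mid\langle m,n\rangle\ge-1\ \forall m\in\Delta\}$ is also a lattice polytope; the same definitions apply to any pair of dual lattices (in either order). $\tilde M=M\oplus\mathbb Z^k$ with $\{e_1,\dots,e_k\}$ the standard basis of $\mathbb Z^k$; $\tilde N=N\oplus\mathbb Z^k$ is the dual lattice with $\{e_1^*,\dots,e_k^*\}$ the dual basis of $\mathbb Z^k$. $\min\langle\Delta_i,u\rangle=\min_{x\in\Delta_i}\langle x,u\rangle$. $\mathrm{Conv}(P_0,\dots,P_k)$ is the convex hull of the union. *)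

(* Defs.v *)
From mathcomp Require Import all_boot all_order all_algebra.
From mathcomp Require Import all_classical all_reals all_analysis.
Set Implicit Arguments.
Unset Strict Implicit.
Unset Printing Implicit Defensive.
Import Order.TTheory GRing.Theory Num.Theory.
Import numFieldNormedType.Exports.
Local Open Scope classical_set_scope.
Local Open Scope ring_scope.

(* Two dual lattices M and N of rank n are identified with Z^n by a basis of M
   and the dual basis of N, so that both real extensions are 'rV[R]_n and the
   duality is the dot product.  Likewise M (+) Z^k and N (+) Z^k live in
   'rV[R]_(n + k), with row_mx x a standing for (x, a). *)

Section Polytopes.
Context {R : realType}.

Definition pairing n (m u : 'rV[R]_n) : R := \sum_j m 0 j * u 0 j.

Definition convex_hull (V : lmodType R) (A : set V) : set V :=
  smallest (@convex_set R V) A.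

Definition translate (V : lmodType R) (A : set V) (v : V) : set V :=
  [set x + v | x in A].

Definition dilate (V : lmodType R) (c : R) (A : set V) : set V :=
  [set c *: x | x in A].

Definition minkowski_sum (V : lmodType R) (I : finType) (A : I -> set V) :
    set V :=
  [set \sum_i x i | x in [set x : I -> V | forall i, A i (x i)]].

Definition polytope (V : lmodType R) (P : set V) : Prop :=
  exists s : seq V, P = convex_hull [set` s].

Definition vertex (V : lmodType R) (P : set V) (v : V) : Prop :=
  P v /\ forall (x y : V) (t : R), P x -> P y -> 0 < t < 1 ->
    v = t *: x + (1 - t) *: y -> x = v /\ y = v.

Definition lattice_polytope n (P : set 'rV[R]_n) : Prop :=
  polytope P /\ forall v, vertex P v -> v \is a mxOver Num.int.

Definition polar n (P : set 'rV[R]_n) : set 'rV[R]_n :=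
  [set u | forall m, P m -> - 1 <= pairing m u].

Definition reflexive_polytope n (P : set 'rV[R]_n) : Prop :=
  [/\ lattice_polytope P, interior P 0 & lattice_polytope (polar P)].

(* On a nonempty polytope this infimum is attained. *)
Definition min_pairing n (P : set 'rV[R]_n) (u : 'rV[R]_n) : R :=
  inf [set pairing x u | x in P].

Definition ebasis {n k} (i : 'I_k) : 'rV[R]_(n + k) := row_mx 0 (delta_mx 0 i).

(* ord0 : 'I_k.+1 is the index 0 of e_0, and lift ord0 i (i : 'I_k) runs over
   the indices 1, ..., k.  The dual vectors e_i^* have the same coordinates. *)
Definition evec {n k} (i : 'I_k.+1) : 'rV[R]_(n + k) :=
  if unlift ord0 i is Some j then ebasis j else - \sum_(j < k) ebasis j.

Definition nabla_hat0 n k (Delta : set 'rV[R]_n)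
    (D : 'I_k.+1 -> set 'rV[R]_n) : set 'rV[R]_(n + k) :=
  convex_hull
    ([set row_mx u 0 - \sum_(i < k) min_pairing (D (lift ord0 i)) u *: ebasis i
       | u in polar Delta]
     `|` range (@ebasis n k)).

Definition nabla_hat n k (Delta : set 'rV[R]_n)
    (D : 'I_k.+1 -> set 'rV[R]_n) (i : 'I_k.+1) : set 'rV[R]_(n + k) :=
  if unlift ord0 i is Some j then translate (nabla_hat0 Delta D) (- ebasis j)
  else nabla_hat0 Delta D.

Definition cayley_polytope n k (D : 'I_k.+1 -> set 'rV[R]_n) :
    set 'rV[R]_(n + k) :=
  convex_hull
    (\bigcup_i translate [set row_mx x 0 | x in D i] (evec i)).

End Polytopes.

(* Main.v *)
Require Import Defs.
From mathcomp Require Import all_boot all_order all_algebra.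
From mathcomp Require Import all_classical all_reals all_analysis.
From mathcomp Require Import ring lra.
Import Order.TTheory GRing.Theory Num.Theory.
Import numFieldNormedType.Exports.
Set Implicit Arguments.
Unset Strict Implicit.
Unset Printing Implicit Defensive.
Local Open Scope classical_set_scope.
Local Open Scope ring_scope.

(** For [w] in [N_R (+) R^k] with first component [v], put
    [h_i(w) = min <Delta_i, v> + <e_i, w>].  Since the [e_i] add up to 0,
    the sum of the [h_i(w)] is [min <Delta, v>], so that a point such that
    [h_i(w) >= 0] for [i >= 1] and [h_0(w) >= -1] lies over [Delta^*].
    Decomposing it as
      [(v, -min <Delta_1, v>, ..., -min <Delta_k, v>) + sum_j h_j(w) e_j^*]
    shows that these inequalities define [nabla_hat0].  Rescaled, they become
    [h_i >= -1] for all [i], which define the polar of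
    [C = Conv(Delta_i + e_i)]; hence the Minkowski sum of the [nabla_hat_i] is
    [C^*], and its polar is [C] by the bipolar theorem.  Integrality of the
    vertices holds because each [min <Delta_i, .>] is linear on every face of
    [Delta^*]: only the vertices of [Delta^*], the [e_j^*] and 0 are needed to
    generate [nabla_hat0]. *)

(** * Convex hulls and vertices *)

Lemma set_cons (T : eqType) (x : T) (s : seq T) :
  [set` x :: s] = x |` [set` s].
Proof.
apply/seteqP; split=> y /=; rewrite inE.
  by case/orP => [/eqP|]; [left|right].
by case=> [->|ys]; rewrite ?eqxx // orbC [_ \in _]ys.
Qed.

Section Convexity.
Context {R : realType} {V : lmodType R}.
Implicit Types (A B : set V) (x y z v : V) (t : R).

(** [convex_set] takes its coefficients among packaged elements of the interval [0, 1]; here [t] is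
    a plain real with explicit bounds. *)
Definition convex A :=
  forall x y t, A x -> A y -> 0 <= t <= 1 -> A (t *: x + (1 - t) *: y).

Lemma convex_setP A : @convex_set R V A <-> convex A.
Proof.
split=> [cA x y t Ax Ay t01|cA x y t].
  have ti : Itv.spec (@Itv.num_sem R) (Itv.Real `[0, 1]%Z) t.
    by rewrite /Itv.num_sem /= !in_itv /= ger0_real //; case/andP: t01.
  have := cA x y (Itv.mk ti); rewrite !inE => /(_ Ax Ay); exact.
rewrite !inE => Ax Ay; apply: cA => //.
by apply/andP; split.
Qed.

Lemma convex_hull_convex A : convex (convex_hull A).
Proof.
move=> x y t Ax Ay t01 B [cB AB]; move/convex_setP: (cB); apply=> //.
  exact: Ax.
exact: Ay.
Qed.

Lemma sub_convex_hull A : A `<=` convex_hull A.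
Proof. exact: sub_gen_smallest. Qed.

Lemma convex_hull_sub A B : convex B -> A `<=` B -> convex_hull A `<=` B.
Proof. by move=> cB AB; apply: smallest_sub => //; apply/convex_setP. Qed.

Lemma convex_hull_mono A B :
  A `<=` convex_hull B -> convex_hull A `<=` convex_hull B.
Proof. by move=> AB; apply: convex_hull_sub AB; exact: convex_hull_convex. Qed.

(** Keeping the total weight as a factor avoids normalising: if [a + b] vanishes, so do both
    weights, and any point of [B] serves. *)
Lemma convex_comb2 B x y (a b : R) : convex B -> B x -> B y ->
  0 <= a -> 0 <= b -> exists2 z, B z & a *: x + b *: y = (a + b) *: z.
Proof.
move=> cB Bx By a0 b0; have [ab0|ab0] := eqVneq (a + b) 0.
  exists x => //; have a00 : a = 0 by lra.
  have b00 : b = 0 by lra.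
  by rewrite a00 b00 addr0 !scale0r addr0.
exists ((a / (a + b)) *: x + (1 - a / (a + b)) *: y).
  apply: cB => //; rewrite divr_ge0 ?addr_ge0 //= ler_pdivrMr ?mul1r; lra.
by rewrite scalerDr !scalerA; congr (_ *: _ + _ *: _); field.
Qed.

Lemma convex_comb B (I : Type) (r : seq I) (a : I -> R) (p : I -> V) :
  convex B -> B !=set0 -> (forall i, 0 <= a i) -> (forall i, B (p i)) ->
  exists2 z, B z & \sum_(i <- r) a i *: p i = (\sum_(i <- r) a i) *: z.
Proof.
move=> cB [b Bb] a0 Bp; elim: r => [|i r [z Bz IH]].
  by exists b => //; rewrite !big_nil scale0r.
rewrite !big_cons IH; apply: convex_comb2 => //.
by apply: sumr_ge0.
Qed.

(** The segments from [x] to the hull fill a convex set: in a combination of two such points, the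
    parts in the hull merge into one point by [convex_comb2]. *)
Lemma convex_hull_setU1 A x : A !=set0 ->
  convex_hull (x |` A) =
  [set z | exists t y, [/\ 0 <= t <= 1, convex_hull A y
                         & z = t *: x + (1 - t) *: y]].
Proof.
move=> [a Aa]; apply/seteqP; split; last first.
  move=> _ [t [y [t01 Ay ->]]].
  apply: convex_hull_convex => //; first by apply: sub_convex_hull; left.
  by move: Ay; apply: convex_hull_mono => b ?; apply: sub_convex_hull; right.
apply: convex_hull_sub.
  move=> _ _ t [t1 [y1 [h1 A1 ->]]] [t2 [y2 [h2 A2 ->]]] t01.
  have [|||||z Az zE] := @convex_comb2 (convex_hull A) y1 y2
    (t * (1 - t1)) ((1 - t) * (1 - t2)).
  - exact: convex_hull_convex.
  - by [].
  - by [].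
  - by apply: mulr_ge0; lra.
  - by apply: mulr_ge0; lra.
  exists (t * t1 + (1 - t) * t2), z; split=> //.
    by apply/andP; split; nra.
  rewrite (_ : 1 - (t * t1 + _) = t * (1 - t1) + (1 - t) * (1 - t2));
    last by ring.
  by rewrite -zE !scalerDr !scalerA scalerDl addrACA.
move=> z [->|Az].
  exists 1, a; split; [lra|exact: sub_convex_hull|].
  by rewrite subrr scale0r scale1r addr0.
exists 0, z; split; [lra|exact: sub_convex_hull Az|].
by rewrite scale0r add0r subr0 scale1r.
Qed.

Lemma convex_hull_set1 x : convex_hull [set x] = [set x].
Proof.
apply/seteqP; split; last exact: sub_convex_hull.
apply: convex_hull_sub => // _ _ t -> -> _ /=.
by rewrite -scalerDl addrC subrK scale1r.
Qed.

Lemma convex_hull_nonempty A : convex_hull A !=set0 -> A !=set0.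
Proof.
move=> [x Ax]; apply/set0P/eqP => A0; move: x Ax; rewrite A0.
by apply: (@convex_hull_sub set0 set0).
Qed.

(** If [v] were not in [A], the hull without [v] would still be convex, [v] being extreme, and would
    still contain [A]; so it would be the whole hull. *)
Lemma vertex_convex_hull A v : vertex (convex_hull A) v -> A v.
Proof.
move=> [Av vP]; apply: contrapT => nAv.
suff [_] : (convex_hull A `\ v) v by exact.
apply: (@convex_hull_sub A) => // [x y t [Ax xv] [Ay yv] t01|x Ax]; last first.
  by split; [exact: sub_convex_hull|move=> xv; apply: nAv; rewrite -xv].
split; first exact: convex_hull_convex.
move=> /esym vE; have [t0|t0] := eqVneq t 0.
  by apply: yv; rewrite vE t0 scale0r add0r subr0 scale1r.
have [t1|t1] := eqVneq t 1.
  by apply: xv; rewrite vE t1 subrr scale0r addr0 scale1r.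
have t01' : 0 < t < 1 by rewrite lt_def t0 lt_neqAle t1.
by apply: xv; have [] := vP x y t Ax Ay t01' vE.
Qed.

Lemma convex_hull_vertex A v :
  ~ convex_hull A v -> vertex (convex_hull (v |` A)) v.
Proof.
move=> nAv; have [->|/set0P A0] := eqVneq A set0.
  rewrite setU0 convex_hull_set1; split=> // x y t -> -> //.
split; first by apply: sub_convex_hull; left.
rewrite convex_hull_setU1 // =>
  x y t [a [x' [a01 Ax' xE]]] [b [y' [b01 Ay' yE]]] t01 vE.
have [|||||z Az zE] := @convex_comb2 (convex_hull A) x' y'
  (t * (1 - a)) ((1 - t) * (1 - b)).
- exact: convex_hull_convex.
- by [].
- by [].
- by apply: mulr_ge0; lra.
- by apply: mulr_ge0; lra.
(* This is the weight that falls on the hull of [A]; if it were nonzero, solving for [v] would put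
   [v] in that hull. *)
have c0 : t * (1 - a) + (1 - t) * (1 - b) = 0.
  apply/eqP/negPn/negP => c0; apply: nAv; suff -> : v = z by [].
  apply: (scalerI c0); rewrite -zE.
  rewrite [_ + _](_ : _ = 1 - (t * a + (1 - t) * b)); last by ring.
  rewrite scalerBl scale1r [X in X - _]vE xE yE !scalerDr !scalerA scalerDl.
  by rewrite addrACA [X in X - _]addrC addrK.
have a1 : a = 1 by nra.
have b1 : b = 1 by nra.
by rewrite xE yE a1 b1 subrr !scale0r !addr0 scale1r.
Qed.

(** Generators lying in the hull of the others are discarded one by one; once there are none,
    [convex_hull_vertex] makes each remaining one a vertex. *)
Lemma polytope_vertices (s : seq V) : exists2 s' : seq V,
  convex_hull [set` s'] = convex_hull [set` s]
  & forall v, v \in s' -> vertex (convex_hull [set` s]) v.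
Proof.
have [m] := ubnP (size s); elim: m s => // m IH s /ltnSE sm.
have sE x : x \in s -> [set` s] = x |` [set` rem x s].
  move=> xs; rewrite -set_cons.
  by apply/seteqP; split=> y /=; rewrite (perm_mem (perm_to_rem xs)).
have [[x [xs hx]]|h] :=
  pselect (exists x, x \in s /\ convex_hull [set` rem x s] x).
  have -> : convex_hull [set` s] = convex_hull [set` rem x s].
    apply/seteqP; split; apply: convex_hull_mono; rewrite (sE _ xs).
      by move=> y [->|] //; apply: sub_convex_hull.
    by move=> y ys; apply: sub_convex_hull; right.
  apply: IH; rewrite size_rem //; case: (s) xs sm => //= ? ? _; exact.
exists s => // v vs; rewrite (sE _ vs); apply: convex_hull_vertex => hv.
by apply: h; exists v.
Qed.

End Convexity.

(** * Pairing, separation and polarity *)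

Section Polarity.
Context {R : realType} {n : nat}.
Implicit Types (P : set 'rV[R]_n) (x y u v : 'rV[R]_n).

Lemma pairingC x u : pairing x u = pairing u x.
Proof. by apply: eq_bigr => j _; rewrite mulrC. Qed.

Lemma pairing_is_linear u : linear (fun x => pairing x u).
Proof.
move=> a x y; rewrite /pairing scaler_sumr -big_split.
by apply: eq_bigr => j _; rewrite !mxE mulrDl -mulrA.
Qed.

Lemma pairingDl x y u : pairing (x + y) u = pairing x u + pairing y u.
Proof. by have := pairing_is_linear u 1 x y; rewrite !scale1r. Qed.

Lemma pairing0l u : pairing 0 u = 0.
Proof. by rewrite /pairing big1 // => j _; rewrite mxE mul0r. Qed.

Lemma pairingZl a x u : pairing (a *: x) u = a * pairing x u.
Proof. by have := pairing_is_linear u a x 0; rewrite pairing0l !addr0. Qed.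

Lemma pairingDr x y u : pairing u (x + y) = pairing u x + pairing u y.
Proof. by rewrite pairingC pairingDl !(pairingC u). Qed.

Lemma pairing0r u : pairing u 0 = 0.
Proof. by rewrite pairingC pairing0l. Qed.

Lemma pairingZr a x u : pairing u (a *: x) = a * pairing u x.
Proof. by rewrite pairingC pairingZl (pairingC u). Qed.

Lemma pairing_sqrD x y a :
  pairing (x + a *: y) (x + a *: y) =
  pairing x x + 2 * a * pairing y x + a ^+ 2 * pairing y y.
Proof.
by rewrite !(pairingDl, pairingDr, pairingZl, pairingZr) (pairingC x y); ring.
Qed.

Lemma pairing_sumr (I : Type) (r : seq I) (F : I -> 'rV[R]_n) u :
  pairing u (\sum_(i <- r) F i) = \sum_(i <- r) pairing u (F i).
Proof.
exact: (big_morph (pairing u) (fun x y => pairingDr x y u) (pairing0r u)).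
Qed.

Lemma pairing_suml (I : Type) (r : seq I) (F : I -> 'rV[R]_n) u :
  pairing (\sum_(i <- r) F i) u = \sum_(i <- r) pairing (F i) u.
Proof.
by rewrite pairingC pairing_sumr; apply: eq_bigr => i _; rewrite pairingC.
Qed.

Lemma pairing_self_gt0 x : x != 0 -> 0 < pairing x x.
Proof.
move=> x0; rewrite lt_def sumr_ge0 ?andbT => [|j _];
  last by rewrite -expr2 sqr_ge0.
apply: contraNneq x0 => /eqP; rewrite psumr_eq0 => [/allP xx|j _];
  last by rewrite -expr2 sqr_ge0.
apply/eqP/rowP => j; rewrite mxE.
by have := xx j (mem_index_enum j); rewrite /= mulf_eq0 orbb => /eqP.
Qed.

Lemma pairing_int x u : x \is a mxOver Num.int -> u \is a mxOver Num.int ->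
  pairing x u \is a Num.int.
Proof.
move=> /mxOverP xZ /mxOverP uZ; apply: rpred_sum => j _; exact: rpredM.
Qed.

Lemma convex_halfspace (c : R) u : convex [set x | c <= pairing x u].
Proof.
move=> x y t /= xc yc t01; rewrite pairingDl !pairingZl; nra.
Qed.

Lemma pairing_hull (A : set 'rV[R]_n) (c : R) u :
  (forall x, A x -> c <= pairing x u) ->
  forall x, convex_hull A x -> c <= pairing x u.
Proof. by move=> Ac; apply: convex_hull_sub Ac; exact: convex_halfspace. Qed.

Lemma continuous_pairing (T : topologicalType) (f g : T -> 'rV[R]_n) :
  continuous f -> continuous g -> continuous (fun z => pairing (f z) (g z)).
Proof.
move=> cf cg; apply: continuous_big => [|j _ z]; first exact: add_continuous.
have ch (h : T -> 'rV[R]_n) : continuous h -> h y 0 j @[y --> z] --> h z 0 j.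
  move=> /(_ z) hz; exact: (cvg_comp _ (fun m : 'rV[R]_n => m 0 j) hz
    (@coord_continuous _ _ _ 0 j (h z))).
exact: cvgM (ch f cf) (ch g cg).
Qed.

(** By induction: adding [x] gives a continuous image of the product of [0, 1] with the previous
    hull. *)
Lemma compact_convex_hull (s : seq 'rV[R]_n) :
  compact (convex_hull [set` s]).
Proof.
elim: s => [|x s IH].
  rewrite (_ : convex_hull _ = set0); first exact: compact0.
  by rewrite -subset0; apply: convex_hull_sub.
rewrite set_cons.
have [->|/set0P s0] := eqVneq [set` s] set0.
  by rewrite setU0 convex_hull_set1; exact: compact_set1.
rewrite convex_hull_setU1 //.
pose f (z : R * 'rV[R]_n) := z.1 *: x + (1 - z.1) *: z.2.
rewrite (_ : [set _ | _] = [set f z | z in `[0, 1] `*` convex_hull [set` s]]).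
  apply: continuous_compact;
    last by apply: compact_setX => //; exact: segment_compact.
  apply: continuous_subspaceT => z; apply: cvgD; apply: cvgZ.
  - exact: cvg_fst.
  - exact: cvg_cst.
  - by apply: cvgB; [exact: cvg_cst|exact: cvg_fst].
  - exact: cvg_snd.
apply/seteqP; split=> [z [t [y [t01 ys ->]]]|z [[t y] [/= t01 ys] <-]].
  by exists (t, y) => //; split => //=; rewrite in_itv.
by exists t, y; split => //; move: t01; rewrite in_itv.
Qed.

(** The generators impose finitely many conditions, each of them strict at 0 and hence valid
    nearby. *)
Lemma nbhs_polar_convex_hull (s : seq 'rV[R]_n) :
  interior (polar (convex_hull [set` s])) 0.
Proof.
suff : nbhs (0 : 'rV[R]_n)
  [set u : 'rV[R]_n | forall x, x \in s -> -1 <= pairing x u].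
  apply: filterS => u us m; apply: pairing_hull => x xs; exact: us.
elim: s => [|x s IH]; first by apply: filterE => u x; rewrite in_nil.
have : nbhs (0 : 'rV[R]_n) [set u : 'rV[R]_n | -1 < pairing x u].
  have cx : continuous (fun u => pairing x u).
    by apply: continuous_pairing => [|u]; [exact: cst_continuous|exact: cvg_id].
  apply: (cx 0 [set c : R | -1 < c]).
  rewrite /= pairing0r; apply: lt_nbhsr; lra.
apply: filterS2 IH => u us xu y; rewrite inE => /orP[/eqP ->|];
  first exact: ltW.
exact: us.
Qed.

Lemma interior_opp P v : interior P 0 -> exists2 e : R, 0 < e & P (- e *: v).
Proof.
move=> P0; have : nbhs (0 : R) [set e : R | P (- e *: v)].
  have : (fun e : R => - e *: v) @ nbhs (0 : R) --> - (0 : R) *: v.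
    by apply: cvgZ; [apply: cvgN; exact: cvg_id|exact: cvg_cst].
  by rewrite oppr0 scale0r; apply.
move=> /nbhs_ballP[r /= r0 rP]; exists (r / 2); first lra.
apply: rP; rewrite /ball /= sub0r normrN gtr0_norm; lra.
Qed.

(** A point [q] nearest to [p] exists by compactness; if the inequality failed at some [x], moving
    from [q] towards [x] would come closer to [p]. *)
Lemma closest_point (s : seq 'rV[R]_n) p : [set` s] !=set0 ->
  exists2 q, convex_hull [set` s] q &
  forall x, convex_hull [set` s] x -> pairing q (q - p) <= pairing x (q - p).
Proof.
move=> [a sa]; pose f x := pairing (x - p) (x - p).
have cf : {within convex_hull [set` s], continuous f}.
  apply: continuous_subspaceT.
  have cB : continuous (fun x => x - p).
    by move=> x; exact: (cvgB (@cvg_id _ (nbhs x)) (cvg_cst p)).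
  exact: continuous_pairing.
have [||q] := compact_EVT_min _ _ cf.
- by exists a; exact: sub_convex_hull.
- exact: compact_convex_hull.
rewrite inE => qs qmin; exists q => // x xs; rewrite leNgt; apply/negP => xq.
set d := q - p in xq.
pose c := pairing (x - q) d; pose b := pairing (x - q) (x - q).
have cE : c = pairing x d - pairing q d.
  by rewrite /c pairingDl -scaleN1r pairingZl mulN1r.
have c0 : c < 0 by rewrite cE; lra.
have b0 : 0 <= b by apply: sumr_ge0 => j _; rewrite -expr2 sqr_ge0.
(* moving from [q] towards [x] by this [t] strictly decreases [f] *)
pose t := - c / (b - c).
have t01 : 0 <= t <= 1 by rewrite /t divr_ge0 ?ler_pdivrMr ?mul1r //=; lra.
have := qmin (t *: x + (1 - t) *: q); rewrite inE =>
  /(_ (convex_hull_convex xs qs t01)).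
rewrite /f -/d (_ : _ + _ - p = d + t *: (x - q)); last first.
  by apply/rowP => j; rewrite !mxE; ring.
rewrite pairing_sqrD -/c -/b => h.
(* The change [2 * t * c + t ^+ 2 * b] of [f] thereby becomes [t * (1 + t) * c], which is
   negative. *)
have tb : t * b = - c - t * (- c) by rewrite /t; field; lra.
have t0 : 0 < t by rewrite /t divr_gt0; lra.
nra.
Qed.

(** A point [p] outside the hull is separated from it by means of its nearest point; as 0 is in the
    hull, the separating form can be scaled into the polar while staying below -1 at [p]. *)
Lemma polarK (s : seq 'rV[R]_n) : convex_hull [set` s] 0 ->
  polar (polar (convex_hull [set` s])) = convex_hull [set` s].
Proof.
move=> s0; apply/seteqP; split=> p; last first.
  by move=> ps u /(_ p ps); rewrite pairingC.
move=> pp; apply: contrapT => nps.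
have [q qs qmin] : exists2 q, convex_hull [set` s] q &
  forall x, convex_hull [set` s] x -> pairing q (q - p) <= pairing x (q - p).
  by apply: closest_point; apply: convex_hull_nonempty; exists 0.
have d0 : q - p != 0 by apply/eqP => /subr0_eq qp; apply: nps; rewrite -qp.
have := pairing_self_gt0 d0; rewrite {1}pairingDl -scaleN1r pairingZl.
rewrite scaleN1r; set d := q - p in qmin *; move=> qd.
have := qmin _ s0; rewrite pairing0l => q0.
(* Midpoint of [- pairing q d], which is nonnegative, and the larger [- pairing p d]: so [r^-1 *: d]
   is above -1 on the hull and below -1 at [p]. *)
pose r := (- pairing q d - pairing p d) / 2.
have r0 : 0 < r by rewrite /r; lra.
have := pp (r^-1 *: d).
rewrite pairingZl (pairingC d) -ler_pdivrMl ?invr_gt0 // invrK.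
suff h : polar (convex_hull [set` s]) (r^-1 *: d).
  by move=> /(_ h); rewrite /r; lra.
move=> x xs; rewrite pairingZr -ler_pdivrMl ?invr_gt0 // invrK.
by have := qmin _ xs; rewrite /r; lra.
Qed.

(** Attainment at a generator, and not just somewhere in the hull, is what makes the minimum an
    integer for integral data. *)
Lemma min_pairingP (s : seq 'rV[R]_n) u : [set` s] !=set0 ->
  exists2 x, x \in s &
    min_pairing (convex_hull [set` s]) u = pairing x u /\
    forall y, convex_hull [set` s] y ->
      min_pairing (convex_hull [set` s]) u <= pairing y u.
Proof.
move=> s0; have [x xs xmin] : exists2 x, x \in s &
    forall y, y \in s -> pairing x u <= pairing y u.
  elim: s s0 => [[]//|a s IH _].
  have [s0|/set0P/IH [x xs xmin]] := eqVneq [set` s] set0.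
    exists a; first exact: mem_head.
    move=> y; rewrite inE => /orP[/eqP -> //|ys].
    by have : [set` s] y by []; rewrite s0.
  have [xa|ax] := leP (pairing x u) (pairing a u).
    exists x; first by rewrite inE xs orbT.
    by move=> y; rewrite inE => /orP[/eqP ->|/xmin].
  exists a; first exact: mem_head.
  move=> y; rewrite inE => /orP[/eqP ->|/xmin] //; lra.
have xhull : convex_hull [set` s] x by apply: sub_convex_hull.
have {}xmin y : convex_hull [set` s] y -> pairing x u <= pairing y u.
  by apply: pairing_hull.
have E : min_pairing (convex_hull [set` s]) u = pairing x u.
  apply/eqP; rewrite eq_le; apply/andP; split.
    apply: ge_inf; last by exists x.
    by exists (pairing x u) => _ [y ys <-]; exact: xmin.
  apply: lb_le_inf; first by exists (pairing x u); exists x.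
  by move=> _ [y ys <-]; exact: xmin.
by exists x => //; split=> // y /xmin; rewrite E.
Qed.

(** A polytope is generated by its vertices, and every vertex belongs to any generating set; so
    integrality can be checked on generators. *)
Lemma lattice_polytopeP P : lattice_polytope P <->
  exists2 s : seq 'rV[R]_n, (forall x, x \in s -> x \is a mxOver Num.int)
    & P = convex_hull [set` s].
Proof.
split=> [[[s ->] sZ]|[s sZ ->]].
  by have [s' sE s's] := polytope_vertices s; exists s' => // x /s's /sZ.
by split=> [|v /vertex_convex_hull vs]; [exists s|exact: sZ].
Qed.

End Polarity.

(** * Minima of linear forms *)

Section MinPairing.
Context {R : realType} {n : nat} (P : set 'rV[R]_n).
Context (P_polytope : polytope P).
Context (P_nonempty : P !=set0).

Lemma min_pairing_attained u :
  exists2 x, P x & pairing x u = min_pairing P u.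
Proof.
case: P_polytope => s sE; have : [set` s] !=set0.
  by apply: convex_hull_nonempty; rewrite -sE.
move=> /(@min_pairingP _ _ _ u)[x xs [xu _]]; rewrite sE; exists x => //.
exact: sub_convex_hull.
Qed.

Lemma min_pairing_le x u : P x -> min_pairing P u <= pairing x u.
Proof.
case: P_polytope => s sE Px; have : [set` s] !=set0.
  by apply: convex_hull_nonempty; rewrite -sE.
move=> /(@min_pairingP _ _ _ u)[y _ [_]]; rewrite -sE; exact.
Qed.

Lemma min_pairingZ a u : 0 <= a -> min_pairing P (a *: u) = a * min_pairing P u.
Proof.
move=> a0; have [x Px xu] := min_pairing_attained u.
have [y Py yu] := min_pairing_attained (a *: u).
have := min_pairing_le (a *: u) Px; rewrite pairingZr xu => le1.
have le2 := min_pairing_le u Py; rewrite pairingZr in yu.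
by apply/eqP; rewrite eq_le le1 -yu ler_wpM2l.
Qed.

Lemma min_pairing0 : min_pairing P 0 = 0.
Proof. by have := min_pairingZ 0 (lexx 0); rewrite scale0r mul0r. Qed.

Lemma min_pairing_concave u v t : 0 <= t <= 1 ->
  t * min_pairing P u + (1 - t) * min_pairing P v <=
  min_pairing P (t *: u + (1 - t) *: v).
Proof.
move=> t01; have [x Px <-] := min_pairing_attained (t *: u + (1 - t) *: v).
rewrite pairingDr !pairingZr.
have := min_pairing_le u Px; have := min_pairing_le v Px; nra.
Qed.

End MinPairing.

Lemma min_pairing_int (R : realType) n (P : set 'rV[R]_n) u :
  lattice_polytope P -> P !=set0 -> u \is a mxOver Num.int ->
  min_pairing P u \is a Num.int.
Proof.
move=> /lattice_polytopeP[s sZ ->] /convex_hull_nonempty s0 uZ.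
have [x xs [-> _]] := min_pairingP u s0.
by apply: pairing_int => //; exact: sZ.
Qed.

(** * Cayley polytopes *)

Section Cayley.
Context {R : realType} {n k : nat}.
Implicit Types (u v x : 'rV[R]_n) (w y : 'rV[R]_(n + k)).

Lemma pairing_row_mx x u (a b : 'rV[R]_k) :
  pairing (row_mx x a) (row_mx u b) = pairing x u + pairing a b.
Proof.
rewrite /pairing big_split_ord /=; congr (_ + _); apply: eq_bigr => j _.
  by rewrite !row_mxEl.
by rewrite !row_mxEr.
Qed.

Lemma pairing_row_mx0 x w : pairing (row_mx x 0) w = pairing x (lsubmx w).
Proof. by rewrite -{1}(hsubmxK w) pairing_row_mx pairing0l addr0. Qed.

Lemma sum_row_mx0 (I : finType) (x : I -> 'rV[R]_n) :
  \sum_i row_mx (x i) (0 : 'rV[R]_k) = row_mx (\sum_i x i) 0.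
Proof.
rewrite (big_morph (fun y : 'rV[R]_n => row_mx y (0 : 'rV[R]_k))
  (id1 := 0) (op1 := +%R)) => [//|y z|].
  by rewrite add_row_mx addr0.
exact: row_mx0.
Qed.

Lemma pairing_ebasis (j : 'I_k) w : pairing (ebasis j) w = rsubmx w 0 j.
Proof.
rewrite -{1}(hsubmxK w) /ebasis pairing_row_mx pairing0l add0r /pairing.
rewrite (bigD1 j) //= big1 ?addr0 => [|l lj]; rewrite mxE eqxx ?eqxx ?mul1r //.
by rewrite (negbTE lj) mul0r.
Qed.

Lemma lift0_eqF (j : 'I_k) : (lift ord0 j == ord0) = false.
Proof. by rewrite eq_sym; exact/negbTE/neq_lift. Qed.

Lemma evec_lift (j : 'I_k) : evec (lift ord0 j) = ebasis j :> 'rV[R]_(n + k).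
Proof. by rewrite /evec liftK. Qed.

Lemma evec0 : evec ord0 = - \sum_j ebasis j :> 'rV[R]_(n + k).
Proof. by rewrite /evec unlift_none. Qed.

Lemma sum_evec : \sum_(i < k.+1) evec i = 0 :> 'rV[R]_(n + k).
Proof.
rewrite big_ord_recl evec0 (eq_bigr _ (fun j _ => evec_lift j)).
by rewrite addrC subrr.
Qed.

Lemma lsubmx_ebasis (j : 'I_k) : lsubmx (ebasis j : 'rV[R]_(n + k)) = 0.
Proof. by rewrite /ebasis row_mxKl. Qed.

Lemma lsubmx_evec (i : 'I_k.+1) : lsubmx (evec i : 'rV[R]_(n + k)) = 0.
Proof.
rewrite /evec; case: unlift => [j|]; first exact: lsubmx_ebasis.
rewrite raddfN raddf_sum big1 ?oppr0 // => j _; exact: lsubmx_ebasis.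
Qed.

Lemma pairing_ebasis2 (i j : 'I_k) :
  pairing (ebasis i) (ebasis j : 'rV[R]_(n + k)) = (i == j)%:R.
Proof. by rewrite pairing_ebasis /ebasis row_mxKr mxE eqxx. Qed.

(** The values are [k] at index 0 and -1 elsewhere; this form fits the map that dilates by [k.+1]
    and shifts by [evec ord0]. *)
Lemma pairing_evec0 (i : 'I_k.+1) :
  pairing (evec i) (evec ord0 : 'rV[R]_(n + k)) = (i == ord0)%:R * k.+1%:R - 1.
Proof.
have e0 j : pairing (ebasis j) (evec ord0 : 'rV[R]_(n + k)) = -1.
  rewrite evec0 -scaleN1r pairingZr pairing_sumr (bigD1 j) //=.
  rewrite pairing_ebasis2 eqxx big1 ?addr0 ?mulr1 // => l lj.
  by rewrite pairing_ebasis2 eq_sym (negbTE lj).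
case: (unliftP ord0 i) => [j ->|->].
  by rewrite evec_lift e0 lift0_eqF mul0r sub0r.
rewrite {1}evec0 -scaleN1r pairingZl pairing_suml (eq_bigr _ (fun j _ => e0 j)).
by rewrite sumr_const card_ord eqxx mul1r -natr1 mulN1r mulNrn opprK addrK.
Qed.

Lemma ebasis_int (j : 'I_k) : (ebasis j : 'rV[R]_(n + k)) \is a mxOver Num.int.
Proof.
apply/mxOverP => a l; rewrite /ebasis mxE.
by case: (fintype.split _) => b; rewrite mxE.
Qed.

Lemma evec_int (i : 'I_k.+1) : (evec i : 'rV[R]_(n + k)) \is a mxOver Num.int.
Proof.
rewrite /evec; case: unlift => [j|]; first exact: ebasis_int.
apply/mxOverP => a l; rewrite mxE rpredN summxE rpred_sum // => j _.
exact: (mxOverP (ebasis_int j)).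
Qed.

Lemma row_mx0_int u : u \is a mxOver Num.int ->
  (row_mx u 0 : 'rV[R]_(n + k)) \is a mxOver Num.int.
Proof.
move=> /mxOverP uZ; apply/mxOverP => a l; rewrite mxE.
case: (fintype.split _) => b //.
by rewrite mxE.
Qed.

(** * Heights attached to the Minkowski decomposition *)

Context (Delta : set 'rV[R]_n) (D : 'I_k.+1 -> set 'rV[R]_n).
Context (Delta_reflexive : reflexive_polytope Delta).
Context (D_lattice : forall i, lattice_polytope (D i)).
Context (Delta_sum : Delta = minkowski_sum D).

Let D_nonempty i : D i !=set0.
Proof.
have [_ /interior_subset + _] := Delta_reflexive.
rewrite Delta_sum => -[x Dx _]; exists (x i); exact: Dx.
Qed.

Let D_polytope i : polytope (D i). Proof. by have [] := D_lattice i. Qed.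

Let minimizers u : exists x : 'I_k.+1 -> 'rV[R]_n,
  forall i, D i (x i) /\ pairing (x i) u = min_pairing (D i) u.
Proof.
have /choice[x xP] i : exists x, D i x /\ pairing x u = min_pairing (D i) u.
  by have [x] := min_pairing_attained (D_polytope i) (D_nonempty i) u; exists x.
by exists x.
Qed.

Local Notation m := (fun i => min_pairing (D i)).

(** The lowest point over [u] at which all heights of positive index are nonnegative; they vanish
    there. *)
Definition graph_point (D : 'I_k.+1 -> set 'rV[R]_n) u : 'rV[R]_(n + k) :=
  row_mx u 0 - \sum_(i < k) min_pairing (D (lift ord0 i)) u *: ebasis i.

Definition height (D : 'I_k.+1 -> set 'rV[R]_n) (i : 'I_k.+1) w : R :=
  min_pairing (D i) (lsubmx w) + pairing (evec i) w.

Local Notation g := (graph_point D).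
Local Notation h := (height D).
Local Notation M u := (\sum_i min_pairing (D i) u).

(** A linear form on a Minkowski sum is minimised in each summand independently. *)
Lemma polar_sum u : polar Delta u <-> -1 <= M u.
Proof.
rewrite Delta_sum; split=> [uP|uM _ [x Dx <-]]; last first.
  apply: le_trans uM _; rewrite pairing_suml; apply: ler_sum => i _.
  exact: min_pairing_le.
have [x xP] := minimizers u.
rewrite -(eq_bigr _ (fun i _ => (xP i).2)) -pairing_suml; apply: uP.
by exists x => // i; exact: (xP i).1.
Qed.

(** As 0 is interior, [Delta] contains some [- e *: u] with [e > 0]; its pairing with [u] is
    negative and bounds the sum from above. *)
Lemma sum_min_pairing_lt0 u : u != 0 -> M u < 0.
Proof.
move=> u0; have [_ /interior_opp - /(_ u)[e e0] + _] := Delta_reflexive.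
rewrite {1}Delta_sum => -[x Dx xE].
apply: (@le_lt_trans _ _ (pairing (- e *: u) u)).
  rewrite -xE pairing_suml; apply: ler_sum => i _; exact: min_pairing_le.
by rewrite pairingZl mulNr oppr_lt0 mulr_gt0 // pairing_self_gt0.
Qed.

Lemma height_sum w : \sum_i h i w = M (lsubmx w).
Proof. by rewrite big_split /= -pairing_suml sum_evec pairing0l addr0. Qed.

Lemma sum_ebasis (c : 'I_k -> R) :
  \sum_j c j *: ebasis j = row_mx 0 (\row_j c j) :> 'rV[R]_(n + k).
Proof.
apply/rowP => l; rewrite summxE !mxE; case: fintype.splitP => j lj.
  rewrite mxE big1 // => i _; rewrite !mxE; case: fintype.splitP => j' lj'.
    by rewrite mxE mulr0.
  by have := ltn_ord j; rewrite -lj lj' ltnNge leq_addr.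
rewrite mxE (bigD1 j) //= big1 => [|i ij]; rewrite !mxE.
  rewrite addr0; case: fintype.splitP => j' lj'.
    by have := ltn_ord j'; rewrite -lj' lj ltnNge leq_addr.
  rewrite mxE eqxx; suff -> : j' = j by rewrite eqxx mulr1.
  by apply/val_inj/(@addnI n); rewrite -lj -lj'.
case: fintype.splitP => j' lj'; first by rewrite mxE mulr0.
rewrite mxE eqxx /=; have [jj|_] := eqVneq j' i; last by rewrite mulr0.
case/eqP: ij; apply/val_inj/(@addnI n); rewrite -lj -jj //.
Qed.

Lemma graph_pointE u : g u = row_mx u (\row_j - m (lift ord0 j) u).
Proof.
rewrite /graph_point sum_ebasis opp_row_mx add_row_mx oppr0 addr0 add0r.
by congr row_mx; apply/rowP => j; rewrite !mxE.
Qed.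

Lemma height_lift (j : 'I_k) w :
  h (lift ord0 j) w = m (lift ord0 j) (lsubmx w) + rsubmx w 0 j.
Proof. by rewrite /height evec_lift pairing_ebasis. Qed.

Lemma height_decomposition w :
  w = g (lsubmx w) + \sum_j h (lift ord0 j) w *: ebasis j.
Proof.
rewrite graph_pointE sum_ebasis add_row_mx addr0 -[LHS]hsubmxK; congr row_mx.
by apply/rowP => j; rewrite !mxE height_lift !mxE addKr.
Qed.

Lemma height_graph_lift (j : 'I_k) u : h (lift ord0 j) (g u) = 0.
Proof. by rewrite height_lift graph_pointE row_mxKl row_mxKr mxE subrr. Qed.

Lemma height_graph0 u : h ord0 (g u) = M u.
Proof.
have := height_sum (g u); rewrite big_ord_recl graph_pointE row_mxKl => <-.
by rewrite -graph_pointE big1 ?addr0 // => j _; exact: height_graph_lift.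
Qed.

Lemma height_ebasis (j : 'I_k) (i : 'I_k.+1) :
  h i (ebasis j) = (i == lift ord0 j)%:R - (i == ord0)%:R.
Proof.
rewrite /height lsubmx_ebasis.
rewrite (min_pairing0 (D_polytope i) (D_nonempty i)) add0r.
case: (unliftP ord0 i) => [l ->|->].
  by rewrite evec_lift pairing_ebasis2 (inj_eq lift_inj) lift0_eqF subr0.
rewrite (negbTE (neq_lift _ _)) eqxx sub0r evec0.
rewrite -scaleN1r pairingZl pairing_suml.
rewrite (bigD1 j) //= pairing_ebasis2 eqxx big1 ?addr0 ?mulr1 // => l lj.
by rewrite pairing_ebasis2 (negbTE lj).
Qed.

Definition height_region (D : 'I_k.+1 -> set 'rV[R]_n) : set 'rV[R]_(n + k) :=
  [set w | forall i, - (i == ord0)%:R <= height D i w].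

Lemma convex_height_region : convex (height_region D).
Proof.
move=> x y t xP yP t01 i; have := xP i; have := yP i; rewrite /height.
rewrite raddfD /= !linearZ /= pairingDr !pairingZr.
have := min_pairing_concave (D_polytope i) (D_nonempty i)
  (lsubmx x) (lsubmx y) t01.
nra.
Qed.

Lemma nabla_hat0_sub_region : nabla_hat0 Delta D `<=` height_region D.
Proof.
apply: convex_hull_sub; first exact: convex_height_region.
move=> _ [[u /polar_sum uM <-]|[j _ <-]] i.
  rewrite -/(g u); case: (unliftP ord0 i) => [l ->|->].
    by rewrite height_graph_lift lift0_eqF oppr0.
  by rewrite height_graph0 eqxx.
by rewrite height_ebasis lerBrDr addrC subrr ler0n.
Qed.

Lemma graph_pointZ a u : 0 <= a -> g (a *: u) = a *: g u.
Proof.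
move=> a0; rewrite !graph_pointE scale_row_mx; congr row_mx.
apply/rowP => j; rewrite !mxE mulrN min_pairingZ //.
Qed.

Lemma graph_point0 : g 0 = 0.
Proof. by have := graph_pointZ 0 (lexx 0); rewrite !scale0r. Qed.

(** * Finite generation of the region, and its dilated translate *)

Context (s : seq 'rV[R]_n).
Context (polar_hull : polar Delta = convex_hull [set` s]).

(** The point 0 absorbs the missing weight when a decomposition has total weight less than 1. *)
Definition nabla_points (D : 'I_k.+1 -> set 'rV[R]_n) (s : seq 'rV[R]_n) :
    seq 'rV[R]_(n + k) :=
  0 :: [seq graph_point D u | u <- s] ++ [seq ebasis j | j <- enum 'I_k].

Local Notation H := (convex_hull [set` nabla_points D s]).

Let H0 : H 0.
Proof. by apply: sub_convex_hull; rewrite /= mem_head. Qed.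

Let Hebasis j : H (ebasis j).
Proof.
apply: sub_convex_hull; rewrite /= inE mem_cat; apply/or3P; apply: Or33.
by apply: map_f; rewrite mem_enum.
Qed.

(* The minimizers [x i] at a boundary point [v] of the dual polytope stay
   minimizers on the face cut out by [\sum_i x i], which contains [v]; hence all
   the [min_pairing (D i)] are linear on this face. *)
Lemma graph_point_face v : M v = - 1 -> H (g v).
Proof.
move=> vM; have vP : polar Delta v by apply/polar_sum; rewrite vM.
have [x xP] := minimizers v.
pose X := \sum_i x i.
(* A linear map that agrees with [g] wherever the [x i] are minimizers. *)
pose L u : 'rV[R]_(n + k) := row_mx u (\row_j - pairing (x (lift ord0 j)) u).
have LE t (y z : 'rV[R]_n) :
    L (t *: y + (1 - t) *: z) = t *: L y + (1 - t) *: L z.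
  rewrite /L !scale_row_mx add_row_mx; congr row_mx; apply/rowP => j.
  by rewrite !mxE pairingDr !pairingZr; ring.
(* The inequality makes the predicate convex: equality at a proper combination forces equality at
   both ends. *)
suff /(_ v) : polar Delta `<=`
    [set u | -1 <= pairing X u /\ (pairing X u = -1 -> H (L u))].
  move=> /(_ vP)[_]; rewrite graph_pointE pairing_suml.
  rewrite (eq_bigr _ (fun i _ => (xP i).2)).
  move=> /(_ vM); rewrite /L (_ : \row_j _ = \row_j - m (lift ord0 j) v) //.
  by apply/rowP => j; rewrite !mxE (xP _).2.
rewrite polar_hull; apply: convex_hull_sub =>
  [y z t [y1 yH] [z1 zH] t01 /=|u us].
  rewrite pairingDr !pairingZr; split; first nra.
  rewrite LE => yz; have [t0|t0] := eqVneq t 0.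
    by move: yz; rewrite t0 !scale0r !subr0 !scale1r !add0r mul0r add0r mul1r;
      exact: zH.
  have [t1|t1] := eqVneq t 1.
    by move: yz; rewrite t1 subrr !scale0r !scale1r !addr0 mul1r mul0r addr0;
      exact: yH.
  have t00 : 0 < t by rewrite lt_def t0; case/andP: t01.
  have t11 : t < 1 by rewrite lt_neqAle t1; case/andP: t01.
  by apply: convex_hull_convex => //; [apply: yH|apply: zH]; nra.
have uP : polar Delta u by rewrite polar_hull; apply: sub_convex_hull.
split; first by apply: uP; rewrite Delta_sum; exists x => // i; exact: (xP i).1.
rewrite pairing_suml => uX; have uM := (polar_sum u).1 uP.
(* The differences are nonnegative and add up to [-1 - M u], which is at most 0. *)
have mx i : pairing (x i) u = m i u.
  apply/eqP; rewrite -subr_eq0; move: i.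
  have le0 i : 0 <= pairing (x i) u - m i u.
    by rewrite subr_ge0 min_pairing_le //; exact: (xP i).1.
  have : \sum_i (pairing (x i) u - m i u) == 0.
    by rewrite eq_le sumr_ge0 ?andbT // sumrB uX; lra.
  rewrite psumr_eq0 // => /allP xm i; exact: xm (mem_index_enum i).
rewrite (_ : L u = g u).
  apply: sub_convex_hull; rewrite /= inE mem_cat; apply/or3P; apply: Or32.
  exact: map_f.
by rewrite graph_pointE; congr row_mx; apply/rowP => j; rewrite !mxE mx.
Qed.

Lemma height_region_sub_hull : height_region D `<=` H.
Proof.
move=> w wP; have cH : convex H by exact: convex_hull_convex.
pose v := lsubmx w.
(* For nonzero [v], dividing by [- M v] moves [v] to the boundary of the dual polytope, where
   [graph_point_face] applies. *)
have [y Hy yE] : exists2 y, H y & g v = - M v *: y.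
  have [v0|v0] := eqVneq v 0.
    by exists 0 => //; rewrite v0 scaler0 graph_point0.
  have Mv := sum_min_pairing_lt0 v0.
  exists (g ((- M v)^-1 *: v)); last first.
    by rewrite -graph_pointZ ?scalerA ?mulfV ?scale1r //; lra.
  apply: graph_point_face; rewrite (eq_bigr (fun i => (- M v)^-1 * m i v)).
    by rewrite -mulr_sumr invrN mulNr mulVf //; lra.
  by move=> i _; rewrite min_pairingZ // invr_ge0; lra.
have Mv : M v <= 0.
  have [->|/sum_min_pairing_lt0 /ltW //] := eqVneq v 0.
  by rewrite big1 // => i _; exact: min_pairing0.
have h0 j : 0 <= h (lift ord0 j) w.
  by have := wP (lift ord0 j); rewrite lift0_eqF oppr0.
have [||||z Hz zE] := @convex_comb _ _ H _ (index_enum 'I_k)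
  (fun j => h (lift ord0 j) w) ebasis.
- exact: cH.
- by exists 0.
- exact: h0.
- exact: Hebasis.
rewrite (height_decomposition w) -/v yE zE.
set S : R := \sum_j h (lift ord0 j) w.
have S0 : 0 <= S by apply: sumr_ge0.
(* Since all heights add up to [M v], the left side is [- h ord0 w]. *)
have SM : - M v + S <= 1.
  have wP0 : -1 <= h ord0 w := wP ord0.
  by have := height_sum w; rewrite big_ord_recl -/S -/v => <-; lra.
have [|||||z' Hz' ->] := @convex_comb2 _ _ H y z (- M v) S;
  rewrite ?oppr_ge0 //.
have := cH z' 0 (- M v + S) Hz' H0; rewrite scaler0 addr0; apply; lra.
Qed.

(** Passing through [height_region] replaces the family over all of [polar Delta] by finitely many
    generators. *)
Lemma nabla_hat0_hull : nabla_hat0 Delta D = H.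
Proof.
apply/seteqP; split.
  exact: subset_trans nabla_hat0_sub_region height_region_sub_hull.
apply: convex_hull_mono => w /=; rewrite inE mem_cat =>
  /or3P[/eqP ->|/mapP[u us ->]|/mapP[j _ ->]].
- apply: sub_convex_hull; left; exists 0; last exact: graph_point0.
  by move=> u _; rewrite pairing0r; lra.
- apply: sub_convex_hull; left; exists u => //.
  by rewrite polar_hull; exact: sub_convex_hull.
- by apply: sub_convex_hull; right; exists j.
Qed.

Lemma nabla_hat0_region : nabla_hat0 Delta D = height_region D.
Proof.
apply/seteqP; split; first exact: nabla_hat0_sub_region.
rewrite nabla_hat0_hull; exact: height_region_sub_hull.
Qed.

Lemma nabla_points_int : (forall u, u \in s -> u \is a mxOver Num.int) ->
  forall w, w \in nabla_points D s -> w \is a mxOver Num.int.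
Proof.
move=> sZ w; rewrite inE mem_cat => /or3P[/eqP ->|/mapP[u us ->]|/mapP[j _ ->]].
- by apply/mxOverP => a l; rewrite mxE.
- rewrite graph_pointE; apply/mxOverP => a l; rewrite mxE.
  case: fintype.split => j; first exact: (mxOverP (sZ u us)).
  by rewrite mxE rpredN min_pairing_int // sZ.
- exact: ebasis_int.
Qed.

(** All summands are translates of one convex set, in which any [k.+1] points add up to [k.+1] times
    a single point; the translations add up to [evec ord0]. *)
Lemma minkowski_sum_nabla_hat : minkowski_sum (nabla_hat Delta D) =
  translate (dilate k.+1%:R (nabla_hat0 Delta D)) (evec ord0).
Proof.
pose a (i : 'I_k.+1) : 'rV[R]_(n + k) :=
  if unlift ord0 i is Some j then - ebasis j else 0.
have aE i : nabla_hat Delta D i = translate (nabla_hat0 Delta D) (a i).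
  rewrite /nabla_hat /a; case: unlift => //.
  apply/seteqP; split=> [w wP|_ [w wP <-]].
    by exists w => //; rewrite addr0.
  by rewrite addr0.
have a_sum : \sum_i a i = evec ord0.
  rewrite big_ord_recl /a unlift_none add0r evec0 -sumrN.
  by apply: eq_bigr => j _; rewrite liftK.
apply/seteqP; split=> [_ [x xP <-]|_ [_ [w wP <-] <-]].
  have /choice[p pP] i : exists p, nabla_hat0 Delta D p /\ x i = p + a i.
    by have := xP i; rewrite aE => -[p pP <-]; exists p.
  have [||||z zP zE] := @convex_comb _ _ (nabla_hat0 Delta D) _
    (index_enum 'I_k.+1) (fun=> 1) p.
  - exact: convex_hull_convex.
  - by exists (p ord0); exact: (pP ord0).1.
  - by move=> _; exact: ler01.
  - by move=> i; exact: (pP i).1.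
  exists (k.+1%:R *: z); first by exists z.
  rewrite (eq_bigr _ (fun i _ => (pP i).2)) big_split /= a_sum; congr (_ + _).
  rewrite -(eq_bigr _ (fun i _ => scale1r (p i))) zE.
  by rewrite sumr_const card_ord.
exists (fun i => w + a i); first by move=> i; rewrite aE; exists w.
by rewrite big_split /= a_sum sumr_const card_ord scaler_nat.
Qed.

Lemma polar_cayley : polar (cayley_polytope D) =
  translate (dilate k.+1%:R (nabla_hat0 Delta D)) (evec ord0).
Proof.
have k0 : 0 < k.+1%:R :> R by rewrite ltr0n.
(* Under this affine map the bounds -1 at index 0 and 0 elsewhere all become -1. *)
have heightE i w : h i (k.+1%:R *: w + evec ord0) =
    k.+1%:R * (h i w + (i == ord0)%:R) - 1.
  rewrite /height raddfD /= linearZ /= lsubmx_evec addr0.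
  rewrite min_pairingZ ?(ltW k0) // pairingDr pairingZr pairing_evec0; ring.
have regionE w : height_region D w <->
    forall i, -1 <= h i (k.+1%:R *: w + evec ord0).
  split=> wP i; have := wP i; rewrite heightE.
    by move=> hw; rewrite lerBrDr addNr mulr_ge0 ?(ltW k0) // -lerBlDr sub0r.
  by rewrite lerBrDr addNr pmulr_rge0 // -lerBlDr sub0r.
rewrite nabla_hat0_region; apply/seteqP; split=>
  [w wP|_ [_ [w /regionE wP <-] <-]].
  pose w' := k.+1%:R^-1 *: (w - evec ord0).
  have wE : k.+1%:R *: w' + evec ord0 = w.
    by rewrite scalerA mulfV ?gt_eqF // scale1r subrK.
  exists (k.+1%:R *: w') => //; exists w' => //; apply/regionE => i; rewrite wE.
  have [x Dx] := min_pairing_attained (D_polytope i) (D_nonempty i) (lsubmx w).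
  rewrite /height => <-; rewrite -pairing_row_mx0 -pairingDl; apply: wP.
  apply: sub_convex_hull; exists i => //.
  by exists (row_mx x 0) => //; exists x.
apply: pairing_hull => _ [i _ [_ [x Dx <-] <-]].
apply: le_trans (wP i) _; rewrite pairingDl pairing_row_mx0 lerD2r.
exact: min_pairing_le.
Qed.

(** Write 0 in [Delta] as the sum of the [x i]; the average of the points [x i] shifted by [evec i]
    is then 0. This makes [polarK] applicable. *)
Lemma cayley_polytope0 : cayley_polytope D 0.
Proof.
have [_ /interior_subset + _] := Delta_reflexive.
rewrite Delta_sum => -[x Dx xE].
pose p i : 'rV[R]_(n + k) := row_mx (x i) 0 + evec i.
have pP i : cayley_polytope D (p i).
  apply: sub_convex_hull; exists i => //; exists (row_mx (x i) 0) => //.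
  by exists (x i); first exact: Dx.
have [||||z zP] := @convex_comb _ _ (cayley_polytope D) _ (index_enum 'I_k.+1)
  (fun=> 1) p.
- exact: convex_hull_convex.
- by exists (p ord0).
- by move=> _; exact: ler01.
- exact: pP.
rewrite (eq_bigr _ (fun i _ => scale1r (p i))) big_split /= sum_evec addr0.
rewrite sum_row_mx0 xE row_mx0 => /esym/eqP.
by rewrite scaler_eq0 sumr_const card_ord pnatr_eq0 /= => /eqP <-.
Qed.

End Cayley.

(** * Integrality of affine images and of the Cayley polytope *)

Lemma affine_image_hull (R : realType) (V : lmodType R) (A : set V)
    (c : R) (v : V) :
  translate (dilate c (convex_hull A)) v =
  convex_hull [set c *: x + v | x in A].
Proof.
apply/seteqP; split=> [_ [_ [x xA <-] <-]|].
  move: x xA; apply: (@convex_hull_sub _ _ A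
    [set x | convex_hull [set c *: x + v | x in A] (c *: x + v)]).
    move=> x y t /= xA yA t01; have := convex_hull_convex xA yA t01.
    rewrite !scalerDr addrACA -scalerDl [t + _]addrC subrK scale1r !scalerA.
    by rewrite ![_ * c]mulrC.
  by move=> x Ax; apply: sub_convex_hull; exists x.
apply: convex_hull_sub =>
  [_ _ t [_ [x xA <-] <-] [_ [y yA <-] <-] t01|_ [x Ax <-]].
  exists (c *: (t *: x + (1 - t) *: y));
    first by exists (t *: x + (1 - t) *: y) => //; exact: convex_hull_convex.
  rewrite !scalerDr [RHS]addrACA -scalerDl [t + _]addrC subrK scale1r !scalerA.
  by rewrite ![_ * c]mulrC.
by exists (c *: x) => //; exists x => //; exact: sub_convex_hull.
Qed.

Lemma lattice_polytope_affine (R : realType) n (s : seq 'rV[R]_n) (c : nat) v :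
  (forall x, x \in s -> x \is a mxOver Num.int) -> v \is a mxOver Num.int ->
  lattice_polytope (translate (dilate c%:R (convex_hull [set` s])) v).
Proof.
move=> sZ vZ; rewrite affine_image_hull; apply/lattice_polytopeP.
exists [seq c%:R *: x + v | x <- s].
  move=> _ /mapP[x xs ->]; apply/mxOverP => i j; rewrite !mxE.
  by rewrite rpredD ?rpredM ?rpred_nat ?(mxOverP vZ) ?(mxOverP (sZ x xs)).
congr convex_hull; apply/seteqP; split=> [_ [x xs <-]|_ /mapP[x xs ->]] /=.
  exact: map_f.
by exists x.
Qed.

Lemma lattice_cayley (R : realType) n k (D : 'I_k.+1 -> set 'rV[R]_n) :
  (forall i, lattice_polytope (D i)) -> lattice_polytope (cayley_polytope D).
Proof.
move=> DL; have /choice[s sP] i : exists s : seq 'rV[R]_n,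
    (forall x, x \in s -> x \is a mxOver Num.int) /\ D i = convex_hull [set` s].
  by have /lattice_polytopeP[s] := DL i; exists s.
apply/lattice_polytopeP.
exists (flatten [seq [seq (row_mx x 0 + evec i : 'rV[R]_(n + k)) | x <- s i]
                | i <- enum 'I_k.+1]).
  move=> _ /flatten_mapP[i _ /mapP[x xs ->]].
  apply/mxOverP => a l; rewrite mxE rpredD ?(mxOverP (evec_int i)) //.
  exact: (mxOverP (row_mx0_int ((sP i).1 x xs))).
apply/seteqP; split; apply: convex_hull_mono => w.
  move=> [i _ [_ [x Dx <-] <-]]; move: x Dx; rewrite (sP i).2.
  set H := convex_hull [set` flatten _].
  apply: (@convex_hull_sub _ _ _ [set x | H (row_mx x 0 + evec i)]) =>
    [x y t /= Hx Hy t01|x xs /=].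
    have := convex_hull_convex Hx Hy t01; rewrite !scalerDr addrACA -scalerDl.
    rewrite [t + _]addrC subrK scale1r !scale_row_mx add_row_mx.
    by rewrite !scaler0 addr0.
  by apply: sub_convex_hull; apply/flatten_mapP; exists i;
    rewrite ?mem_enum //; exact: map_f.
move=> /flatten_mapP[i _ /mapP[x xs ->]].
apply: sub_convex_hull; exists i => //.
exists (row_mx x 0) => //; exists x => //.
by rewrite (sP i).2; exact: sub_convex_hull.
Qed.

Theorem proposition1p11 (R : realType) (n k : nat) (Delta : set 'rV[R]_n)
    (D : 'I_k.+1 -> set 'rV[R]_n)
    (Delta_reflexive : reflexive_polytope Delta)
    (D_lattice : forall i, lattice_polytope (D i))
    (Delta_sum : Delta = minkowski_sum D) :
  [/\ minkowski_sum (nabla_hat Delta D) =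
        translate (dilate k.+1%:R (nabla_hat0 Delta D)) (evec ord0),
      reflexive_polytope (minkowski_sum (nabla_hat Delta D)),
      polar (minkowski_sum (nabla_hat Delta D)) = cayley_polytope D
    & reflexive_polytope (cayley_polytope D)].
Proof.
have sumE := minkowski_sum_nabla_hat Delta D.
have [_ _ /lattice_polytopeP[s sZ polarE]] := Delta_reflexive.
have polarC := polar_cayley Delta_reflexive D_lattice Delta_sum polarE.
have nablaL : lattice_polytope (minkowski_sum (nabla_hat Delta D)).
  rewrite sumE (nabla_hat0_hull Delta_reflexive D_lattice Delta_sum polarE).
  apply: lattice_polytope_affine (evec_int _).
  exact: nabla_points_int Delta_reflexive D_lattice Delta_sum _ sZ.
have cayleyL := lattice_cayley D_lattice.
have cayleyK : polar (polar (cayley_polytope D)) = cayley_polytope D.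
  have := cayley_polytope0 Delta_reflexive Delta_sum.
  by have [[s' ->] _] := cayleyL; exact: polarK.
rewrite -sumE in polarC.
split; rewrite // -?polarC ?cayleyK //; split; rewrite ?cayleyK // ?polarC //.
  by rewrite -polarC; have [[s' ->] _] := cayleyL;
    exact: nbhs_polar_convex_hull.
by rewrite -cayleyK polarC; have [[s' ->] _] := nablaL;
  exact: nbhs_polar_convex_hull.
Qed.
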